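(* Let $s>1$ be an integer, $z\in\mathbb{C}$ and $a$ a parameter for which the Lerch transcendent $\Phi(z,s,a)$ is defined. If the integral converges, then \[ \Phi(z,s,a)=\int_{[0,1]^{s+1}}\frac{-s\prod_{n=1}^{s+1}x_n^{a-1}}{\left(1-z\prod_{n=1}^{s+1}x_n\right)\log\left(\prod_{n=1}^{s+1}x_n\right)}\prod_{n=1}^{s+1}dx_n, \] and \[ \zeta(s)=\int_{[0,1]^{s+1}}\frac{-s}{\left(1-\prod_{k=1}^{s+1}x_k\right)\log\left(\prod_{k=1}^{s+1}x_k\right)}\prod_{k=1}^{s+1}dx_k. \]
   Context: The Lerch transcendent is $\Phi(z,s,a)=\sum_{k=0}^\infty \frac{z^k}{(k+a)^s}$ (where this series converges); $\zeta$ is the Riemann zeta function. *)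

(* Defs.v *)
From HB Require Import structures.
From mathcomp Require Import all_boot all_order all_algebra.
From mathcomp Require Import all_classical all_reals all_analysis.
From mathcomp Require Import complex.

Set Implicit Arguments.
Unset Strict Implicit.
Unset Printing Implicit Defensive.

Import Order.TTheory GRing.Theory Num.Theory.
Import numFieldNormedType.Exports.

Local Open Scope classical_set_scope.
Local Open Scope ring_scope.

Section Defs.
Variable R : realType.

Fixpoint cube_int (n : nat) (F : seq R -> \bar R) : \bar R :=
  match n with
  | 0%N => F [::]
  | m.+1 => (\int[@lebesgue_measure R]_(x in `[0%R, 1%R]) cube_int m (fun t => F (x :: t)))%E
  end.

(* "The integral over [0,1]^n of f converges": f is absolutely integrable,
   i.e. the (Tonelli) integral of |f| is finite. *)
Definition cube_integrable (n : nat) (f : seq R -> R[i]) : Prop :=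
  (cube_int n (fun t => (Normc.normc (f t))%:E) < +oo)%E.

Definition cube_integrable_real (n : nat) (f : seq R -> R) : Prop :=
  (cube_int n (fun t => (`|f t|)%:E) < +oo)%E.

Definition cube_integral (n : nat) (f : seq R -> R[i]) : R[i] :=
  Complex (fine (cube_int n (fun t => (complex.Re (f t))%:E)))
          (fine (cube_int n (fun t => (complex.Im (f t))%:E))).

Definition cube_integral_real (n : nat) (f : seq R -> R) : R :=
  fine (cube_int n (fun t => (f t)%:E)).

(* Complex power x^w of a positive real x: x^w = exp(w log x). *)
Definition cpowR (x : R) (w : R[i]) : R[i] :=
  ((expR (complex.Re w * ln x))%:C)%C * Complex (cos (complex.Im w * ln x)) (sin (complex.Im w * ln x)).

Definition lerch_partial (z : R[i]) (s : nat) (a : R[i]) (N : nat) : R[i] :=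
  \sum_(k < N) z ^+ k / ((k%:R + a) ^+ s).

Definition lerch_defined (z : R[i]) (s : nat) (a : R[i]) : Prop :=
  (forall k : nat, k%:R + a != 0) /\
  cvgn (fun N => complex.Re (lerch_partial z s a N)) /\
  cvgn (fun N => complex.Im (lerch_partial z s a N)).

Definition lerch (z : R[i]) (s : nat) (a : R[i]) : R[i] :=
  Complex (limn (fun N => complex.Re (lerch_partial z s a N)))
          (limn (fun N => complex.Im (lerch_partial z s a N))).

Definition zeta (s : nat) : R :=
  limn (fun N => \sum_(1 <= n < N) ((n%:R : R) ^+ s)^-1).

Definition lerch_integrand (z : R[i]) (s : nat) (a : R[i]) (t : seq R) : R[i] :=
  let P := \prod_(x <- t) x in
  (- (s%:R)) * cpowR P (a - 1) / ((1 - z * (P%:C)%C) * ((ln P)%:C)%C).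

Definition zeta_integrand (s : nat) (t : seq R) : R :=
  let P := \prod_(x <- t) x in
  (- (s%:R)) / ((1 - P) * ln P).

End Defs.

(* Main.v *)
Require Import Defs.
From HB Require Import structures.
From mathcomp Require Import all_boot all_order all_algebra.
From mathcomp Require Import all_classical all_reals all_analysis.
From mathcomp Require Import complex measurable_realfun.
From mathcomp Require Import ring lra.

(** The product of n + 1 independent uniform variables on [0, 1] has density
    (- ln y)^n / n! on [0, 1], so the integral of g (x_1 * ... * x_(s+1)) over
    the cube is the integral of (- ln y)^s / s! * g y over [0, 1]: substitute
    y = q x in the innermost integral and exchange the order of integration,
    one variable at a time.  For the Lerch integrand the logarithm in the
    denominator lowers the exponent, and there remains
      y^(a-1) (- ln y)^(s-1) / (s-1)! / (1 - z y).
    Convergence of the series forces |z| <= 1 and convergence of the integral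
    forces Re a > 0.  The partial sums of the geometric series for
    1 / (1 - z y) are bounded by 2 / |1 - z y|, so dominated convergence
    reduces the formula to the moments
      int_0^1 y^(w-1) (- ln y)^m / m! dy = w^-(m+1)   (Re w > 0).
    The zeta function is the case z = a = 1. *)

Set Implicit Arguments.
Unset Strict Implicit.
Unset Printing Implicit Defensive.

Import Order.TTheory GRing.Theory Num.Theory.
Import numFieldNormedType.Exports.

Local Open Scope classical_set_scope.
Local Open Scope ring_scope.

(** * Iterated integrals of functions of the product *)

Section scaling.
Context {R : realType}.
Local Notation mu := (@lebesgue_measure R).
Variables (c : R) (c0 : 0 < c).

Let scalec : measurableTypeR R -> measurableTypeR R := *%R c.
Let mscalec : measurable_fun setT scalec.
Proof. by apply: continuous_measurable_fun; exact: mulrl_continuous. Qed.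

Let pushc : {measure set (measurableTypeR R) -> \bar R} :=
  measure_function_pushforward__canonical__measure_function_Measure mu mscalec.

(** By uniqueness of Lebesgue measure: [c] times its pushforward under multiplication by [c] gives
    every interval []a, b]] its length. *)
Lemma lebesgue_measure_scale (A : set R) : measurable A ->
  mu A = (c%:E * mu ( *%R c @^-1` A))%E.
Proof.
move=> mA.
pose nu : {measure set (measurableTypeR R) -> \bar R} :=
  mscale (NngNum (ltW c0)) pushc.
suff: mu A = nu A by [].
apply: lebesgue_measure_unique => //= _ [[a b]] _ <-.
rewrite /mscale /= /pushforward.
have -> : scalec @^-1` `]a, b] = `](a / c), (b / c)]%classic.
  apply/seteqP; split => x /=; rewrite !in_itv/= /scalec.
    by rewrite ltr_pdivrMr// ler_pdivlMr// mulrC.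
  by rewrite ltr_pdivrMr// ler_pdivlMr// mulrC.
rewrite !lebesgue_measure_itv/= !lte_fin ltr_pM2r ?invr_gt0//.
case: ifPn => _; last by rewrite mule0.
rewrite -!EFinD -EFinM; congr EFin.
by field; rewrite gt_eqF.
Qed.

(** The substitution y = c x, obtained by pushforward: [[0, 1]] is the preimage of [[0, c]]. Values
    in the extended reals are allowed because [f] will be an inner integral, which may be
    infinite. *)
Lemma ge0_integral_scale (f : R -> \bar R) :
  measurable_fun setT f -> (forall x, (0 <= f x)%E) ->
  (\int[mu]_(x in `[0%R, 1%R]) f (c * x)%R =
   (c^-1)%:E * \int[mu]_(y in `[0%R, c]) f y)%E.
Proof.
move=> mf f0.
have -> : (`[0%R, 1%R]%classic : set R) = scalec @^-1` `[0%R, c].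
  apply/seteqP; split => x /=; rewrite !in_itv/= /scalec.
    by move=> /andP[x0 x1]; rewrite pmulr_rge0// x0/= ger_pMr.
  by rewrite pmulr_rge0// ger_pMr.
have mf' := measurable_funS measurableT (@subsetT _ `[0%R, c]) mf.
rewrite (_ : (\int[mu]_(x in _) _)%E =
    (\int[pushc]_(y in `[0%R, c]) f y)%E); last first.
  by rewrite ge0_integral_pushforward.
rewrite [in RHS](_ : (\int[mu]_(y in _) _ =
    \int[mscale (NngNum (ltW c0)) pushc]_(y in `[0%R, c]) f y)%E); last first.
  apply: eq_measure_integral => A mA _ /=.
  exact: lebesgue_measure_scale.
rewrite ge0_integral_mscale//=.
by rewrite muleA -EFinM mulVf ?mul1e// gt_eqF.
Qed.

End scaling.

(** * Antiderivatives on the positive reals and powers of the logarithm *)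

Section ftc.
Context {R : realType}.
Local Notation mu := (@lebesgue_measure R).

Lemma integral_is_derive_pos (F f : R -> R) (a b : R) : 0 < a -> a <= b ->
  (forall x : R, 0 < x -> is_derive x 1 F (f x)) ->
  (forall x : R, 0 < x -> {for x, continuous f}) ->
  (\int[mu]_(x in `[a, b]) (f x)%:E = (F b - F a)%:E)%E.
Proof.
move=> a0; rewrite le_eqVlt => /predU1P[<-|ab] dF cf.
  by rewrite set_itv1 integral_set1 subrr.
have cF x : 0 < x -> {for x, continuous F}.
  by move=> x0; apply: differentiable_continuous; apply/derivable1_diffP; case: (dF _ x0).
rewrite EFinB; apply: continuous_FTC2 => //.
- apply: continuous_in_subspaceT => x /set_mem /=.
  by rewrite in_itv/= => /andP[ax _]; apply: cf; exact: lt_le_trans ax.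
- split.
  + move=> x; rewrite in_itv/= => /andP[ax _].
    by case: (dF _ (lt_trans a0 ax)).
  + exact/cvg_at_right_filter/cF.
  + exact/cvg_at_left_filter/cF/(lt_trans a0).
- move=> x; rewrite in_itv/= => /andP[ax _].
  have := dF _ (lt_trans a0 ax) => dFx.
  by rewrite derive1E derive_val.
Qed.

(** On [[0, 1]] this is the density of a product of k + 1 independent uniform variables. Since [ln]
    is 0 on nonpositive reals, it vanishes at 0 for k > 0. *)
Definition logpow (k : nat) (x : R) : R := (- ln x) ^+ k / k`!%:R.

Lemma logpow_ge0 k x : x <= 1 -> 0 <= logpow k x.
Proof.
by move=> x1; rewrite /logpow divr_ge0// exprn_ge0// oppr_ge0 ln_le0.
Qed.

Lemma logpow_gt0 k x : 0 < x < 1 -> 0 < logpow k x.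
Proof.
move=> x01; rewrite /logpow divr_gt0 ?ltr0n ?fact_gt0// exprn_gt0// oppr_gt0.
exact: ln_lt0.
Qed.

Lemma logpow_le k x y : 0 < x -> x <= y -> y <= 1 -> logpow k y <= logpow k x.
Proof.
move=> x0 xy y1; rewrite /logpow ler_pM2r ?invr_gt0 ?ltr0n ?fact_gt0//.
apply: lerXn2r; rewrite ?nnegrE ?oppr_ge0 ?ln_le0//; first exact: le_trans y1.
by rewrite lerN2 ler_ln// posrE// (lt_le_trans x0).
Qed.

Lemma measurable_logpow k : measurable_fun setT (logpow k).
Proof.
apply: measurable_funM => //; apply: measurable_funX.
by apply: measurableT_comp => //; exact: measurable_ln.
Qed.

Lemma is_derive_logpow k (x : R) : 0 < x ->
  is_derive x 1 (logpow k.+1) (- (logpow k x / x)).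
Proof.
move=> x0.
have dl := is_derive1_ln x0.
have d := is_deriveZ k.+1`!%:R^-1 (is_deriveX k.+1 (is_deriveN dl)).
rewrite (_ : logpow k.+1 = k.+1`!%:R^-1 \*: ((- @ln R) ^+ k.+1)).
  apply: is_derive_eq.
  rewrite /GRing.scale /= factS natrM /logpow /=; field.
  by rewrite gt_eqF//= nat1r !pnatr_eq0 -lt0n fact_gt0.
by apply/funext => y; rewrite /logpow mulrC exprfctE.
Qed.

Lemma continuous_logpow k (x : R) : 0 < x -> {for x, continuous (logpow k)}.
Proof.
move=> x0; apply: cvgM; last exact: cvg_cst.
have cl : {for x, continuous (fun y => - ln y)}.
  by apply: cvgN; exact: continuous_ln.
exact: (@continuous_comp _ _ _ (fun y => - ln y) (fun y => y ^+ k) x cl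
  (@exprn_continuous _ k _)).
Qed.

(** The antiderivative [- logpow k.+1] vanishes at 1. This is the recursion that links the densities
    for k + 1 and k + 2 uniform factors. *)
Lemma integral_logpow k y : 0 < y -> y <= 1 ->
  (\int[mu]_(q in `[y, 1%R]) (logpow k q / q)%:E = (logpow k.+1 y)%:E)%E.
Proof.
move=> y0 y1.
transitivity ((- logpow k.+1 1 - - logpow k.+1 y)%:E); last first.
  by rewrite /logpow ln1 oppr0 expr0n /= mul0r oppr0 add0r opprK.
apply: (@integral_is_derive_pos (- logpow k.+1)) => // x x0.
- have := is_deriveN (is_derive_logpow k x0).
  by rewrite opprK.
- apply: cvgM; first exact: continuous_logpow.
  by apply: cvgV => //; rewrite gt_eqF.
Qed.

End ftc.

(** * Reduction of the cube integral to one variable, nonnegative case *)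

Section prod_int.
Context {R : realType}.
Local Notation mu := (@lebesgue_measure R).
Local Notation I01 := (`[0%R, 1%R]%classic : set R).

(** Cutting the integrand off outside 0 <= x <= 1 makes this the section integral of a nonnegative
    measurable function of two variables, so Tonelli's theorem applies. *)
Lemma measurable_integral_prod (phi : R -> \bar R) :
  measurable_fun setT phi -> (forall x, 0 <= phi x)%E ->
  measurable_fun setT (fun q : R => \int[mu]_(x in I01) phi (q * x)%R)%E.
Proof.
move=> mphi phi0.
pose K (z : measurableTypeR R * measurableTypeR R) :=
  if (0 <= z.2) && (z.2 <= 1) then phi (z.1 * z.2) else 0%E.
have K0 z : (0 <= K z)%E by rewrite /K; case: ifP.
have mK : measurable_fun setT K.
  apply: measurable_fun_ifT => //.
    by apply: measurable_and; apply: measurable_fun_ler.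
  apply: measurableT_comp => //; exact: measurable_funM.
rewrite (_ : (fun _ => _) = fubini_F mu K).
  exact: measurable_fun_fubini_tonelli_F.
apply/funext => q; rewrite /fubini_F.
rewrite [LHS]integral_mkcond; apply: eq_integral => x _.
by rewrite patchE mem_setE in_itv /= /K.
Qed.

Lemma measurable_invr : measurable_fun setT (@GRing.inv R).
Proof.
rewrite (_ : GRing.inv = fun x : R =>
    if 0 <= x then x `^ (-1) else - ((- x) `^ (-1))).
  apply: measurable_fun_ifT; first exact: measurable_fun_ler.
    exact: measurable_powR.
  apply: (@measurableT_comp _ _ _ _ _ _ (-%R : R -> R)) => //.
  apply: (@measurableT_comp _ _ _ _ _ _ (@powR R ^~ (-1)) _ (-%R : R -> R)) => //.
apply/funext => x; case: ifPn => [x0|]; first by rewrite powR_inv1.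
rewrite -ltNge => x0.
by rewrite powR_inv1 ?oppr_ge0 ?(ltW x0)// invrN opprK.
Qed.

(** One integration is absorbed into the weight: substitute y = q x, exchange the order of
    integration over the triangle 0 < y <= q <= 1, and integrate [logpow k q / q] over q in
    [[y, 1]]. *)
Lemma integral_logpow_prod (k : nat) (phi : R -> \bar R) :
  measurable_fun setT phi -> (forall x, 0 <= phi x)%E ->
  (\int[mu]_(q in I01) ((logpow k q)%:E * \int[mu]_(x in I01) phi (q * x)%R) =
   \int[mu]_(y in I01) ((logpow k.+1 y)%:E * phi y))%E.
Proof.
move=> mphi phi0.
(* The integrand on the triangle, with z = (q, y); the factor 1 / q is the Jacobian of the
   substitution. *)
pose K (z : measurableTypeR R * measurableTypeR R) :=
  if [&& 0 < z.2, z.2 <= z.1 & z.1 <= 1]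
  then ((logpow k z.1 / z.1)%:E * phi z.2)%E else 0%E.
have K0 z : (0 <= K z)%E.
  rewrite /K; case: ifP => // /and3P[z0 zz z1]; apply: mule_ge0 => //.
  by rewrite lee_fin divr_ge0 ?logpow_ge0// (le_trans (ltW z0)).
have mc : measurable_fun setT (fun q : R => logpow k q / q).
  by apply: measurable_funM; [exact: measurable_logpow|exact: measurable_invr].
have mK : measurable_fun setT K.
  apply: measurable_fun_ifT => //.
    apply: measurable_and; first exact: measurable_fun_ltr.
    by apply: measurable_and; apply: measurable_fun_ler.
  apply: emeasurable_funM; last by apply: measurableT_comp.
  apply/measurable_EFinP.
  exact: (measurableT_comp mc measurable_fst).
transitivity (\int[mu]_q \int[mu]_y K (q, y))%E.
  (* The null point q = 0 is removed, as the substitution requires q > 0. *)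
  rewrite -integral_itv_obnd_cbnd; last first.
    apply: measurable_funTS; apply: emeasurable_funM.
      by apply/measurable_EFinP; exact: measurable_logpow.
    exact: measurable_integral_prod.
  rewrite [LHS]integral_mkcond; apply: eq_integral => q _.
  rewrite patchE mem_setE in_itv /=; case: ifPn => [/andP[q0 q1]|qn]; last first.
    rewrite integral0_eq// => y _; rewrite /K /=; case: ifP => // /and3P[y0 yq q1].
    by rewrite q1 (lt_le_trans y0 yq) in qn.
  rewrite ge0_integral_scale// muleA -EFinM.
  rewrite -integral_itv_obnd_cbnd; last exact: measurable_funTS.
  rewrite -ge0_integralZl//; last 2 first.
    - exact: measurable_funTS.
    - by rewrite lee_fin divr_ge0 ?logpow_ge0// ltW.
  rewrite [LHS]integral_mkcond; apply: eq_integral => y _.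
  by rewrite patchE mem_setE in_itv /= /K /= q1 andbT.
rewrite (fubini_tonelli K mK K0).
rewrite -[in RHS]integral_itv_obnd_cbnd; last first.
  apply: measurable_funTS; apply: emeasurable_funM => //.
  by apply/measurable_EFinP; exact: measurable_logpow.
rewrite [in RHS]integral_mkcond; apply: eq_integral => y _.
rewrite patchE mem_setE in_itv /=; case: ifPn => [/andP[y0 y1]|yn]; last first.
  rewrite integral0_eq// => q _; rewrite /K /=; case: ifP => // /and3P[y0 yq q1].
  by rewrite y0 (le_trans yq q1) in yn.
rewrite -integral_logpow// muleC -ge0_integralZl//; last 2 first.
- by apply: measurable_funTS; exact/measurable_EFinP.
- move=> q /=; rewrite in_itv/= => /andP[yq q1].
  by rewrite lee_fin divr_ge0 ?logpow_ge0// (le_trans (ltW y0)).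
rewrite [in RHS]integral_mkcond; apply: eq_integral => q _.
by rewrite patchE mem_setE in_itv /= /K /= y0 /= muleC.
Qed.

(** The parameter [q] stands for the product of the variables already fixed by the outer integrals;
    this is what makes an induction on the remaining ones possible. *)
Definition prod_int (n : nat) (g : R -> \bar R) (q : R) : \bar R :=
  cube_int n (fun t => g (q * \prod_(x <- t) x)).

Lemma prod_int0 g : prod_int 0 g = g.
Proof. by apply/funext => q; rewrite /prod_int /= big_nil mulr1. Qed.

Lemma prod_intS n g q :
  prod_int n.+1 g q = (\int[mu]_(x in I01) prod_int n g (q * x)%R)%E.
Proof.
rewrite /prod_int /=; apply: eq_integral => x _; congr cube_int.
by apply/funext => t; rewrite big_cons mulrA.
Qed.

Lemma cube_int_prod n g :
  cube_int n.+1 (fun t => g (\prod_(x <- t) x)) =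
  (\int[mu]_(x in I01) prod_int n g x)%E.
Proof.
rewrite /=; apply: eq_integral => x _; congr cube_int.
by apply/funext => t; rewrite big_cons.
Qed.

Lemma prod_int_ge0 n g q : (forall x, 0 <= g x)%E -> (0 <= prod_int n g q)%E.
Proof.
move=> g0; elim: n q => [|n ih] q; first by rewrite prod_int0.
by rewrite prod_intS; apply: integral_ge0.
Qed.

Lemma measurable_prod_int n g : measurable_fun setT g -> 
  (forall x, 0 <= g x)%E -> measurable_fun setT (prod_int n g).
Proof.
move=> mg g0; elim: n => [|n ih]; first by rewrite prod_int0.
rewrite (_ : prod_int n.+1 g = fun q => \int[mu]_(x in I01) prod_int n g (q * x)%R)%E.
  by apply: measurable_integral_prod => // x; exact: prod_int_ge0.
by apply/funext => q; rewrite prod_intS.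
Qed.

(** Each inner integral raises the index of the weight by one, so [k] has to vary in the
    induction. *)
Lemma integral_logpow_prod_int k n g : measurable_fun setT g ->
  (forall x, 0 <= g x)%E ->
  (\int[mu]_(q in I01) ((logpow k q)%:E * prod_int n g q) =
   \int[mu]_(q in I01) ((logpow (k + n) q)%:E * g q))%E.
Proof.
move=> mg g0; elim: n k => [|n ih] k; first by rewrite addn0 prod_int0.
rewrite addnS -addSn -ih -integral_logpow_prod.
- by apply: eq_integral => q _; rewrite prod_intS.
- exact: measurable_prod_int.
- by move=> x; exact: prod_int_ge0.
Qed.

(** The outermost variable carries the weight [logpow 0], which is 1; the other n integrals raise
    the index to n. *)
Lemma cube_int_ge0_prod n g : measurable_fun setT g -> (forall x, 0 <= g x)%E ->
  cube_int n.+1 (fun t => g (\prod_(x <- t) x)) =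
  (\int[mu]_(q in I01) ((logpow n q)%:E * g q))%E.
Proof.
move=> mg g0; rewrite cube_int_prod -[n in RHS]add0n -integral_logpow_prod_int//.
by apply: eq_integral => q _; rewrite /logpow expr0 fact0 divr1 mul1e.
Qed.

End prod_int.

(** * The same reduction for real functions of either sign *)

Section signed.
Context {R : realType}.
Local Notation mu := (@lebesgue_measure R).
Local Notation I01 := (`[0%R, 1%R]%classic : set R).

(** The integrand is constant and the cube has volume 1. This settles q = 0, where scaling by [q] is
    not invertible. *)
Lemma prod_int_at0 n (h : R -> R) : prod_int n (EFin \o h) 0 = (h 0)%:E.
Proof.
elim: n => [|n ih]; first by rewrite prod_int0.
rewrite prod_intS; under eq_integral do rewrite mul0r ih.
rewrite integral_cst//= lebesgue_measure_itv/= lte_fin ltr01.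
by rewrite -EFinD subr0 mule1.
Qed.

(* logpow is nonincreasing, so on [0, q] it is bounded below by its value at q. *)
Lemma prod_int_lty n m (h : R -> R) (q : R) :
  measurable_fun setT h -> (forall x, 0 <= h x) ->
  mu.-integrable I01 (fun x => (logpow n x * h x)%:E) ->
  (m <= n.+1)%N -> 0 <= q < 1 -> (prod_int m (EFin \o h) q < +oo)%E.
Proof.
move=> mh h0 inth mn /andP[q0 q1].
have [->|qn0] := eqVneq q 0; first by rewrite prod_int_at0 ltry.
have {}q0 : 0 < q by rewrite lt_neqAle eq_sym qn0.
case: m mn => [|m] mn; first by rewrite prod_int0 /= ltry.
have meh : measurable_fun setT (EFin \o h) by apply/measurable_EFinP.
have eh0 x : (0 <= (EFin \o h) x)%E by rewrite /= lee_fin.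
have mP := measurable_prod_int m meh eh0.
have P0 x := prod_int_ge0 m x eh0.
rewrite prod_intS ge0_integral_scale//.
suff H : (\int[mu]_(y in `[0%R, q]) prod_int m (EFin \o h) y < +oo)%E.
  by rewrite lte_mul_pinfty// lee_fin invr_ge0 ltW.
(* The index satisfies k + m = n, so weighting [prod_int m] by [logpow k] yields the integral of
   [logpow n * h], finite by hypothesis; q < 1 gives c > 0. *)
pose k := (n - m)%N; pose c := logpow k q.
have c0 : 0 < c by apply: logpow_gt0; rewrite q0.
have mL : measurable_fun setT (fun y => (logpow k y)%:E * prod_int m (EFin \o h) y)%E.
  by apply: emeasurable_funM => //; apply/measurable_EFinP; exact: measurable_logpow.
have sub : `]0%R, q] `<=` I01.
  move=> x /=; rewrite !in_itv/= => /andP[x0 xq].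
  by rewrite (ltW x0) (le_trans xq (ltW q1)).
rewrite -integral_itv_obnd_cbnd; last exact: measurable_funTS.
apply: (@le_lt_trans _ _ ((c^-1)%:E * \int[mu]_(y in I01) ((logpow k y)%:E *
    prod_int m (EFin \o h) y))%E).
  rewrite -ge0_integralZl//; last 3 first.
  - exact: measurable_funTS.
  - move=> x /=; rewrite in_itv/= => /andP[_ x1]; apply: mule_ge0 => //.
    by rewrite lee_fin logpow_ge0.
  - by rewrite lee_fin invr_ge0 ltW.
  apply: (@le_trans _ _ (\int[mu]_(y in `]0%R, q]) ((c^-1)%:E *
      ((logpow k y)%:E * prod_int m (EFin \o h) y)))%E).
    apply: ge0_le_integral => //.
    - exact: measurable_funTS.
    - by apply: measurable_funTS; exact: measurable_funeM.
    move=> x /=; rewrite in_itv/= => /andP[x0 xq].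
    rewrite muleA -EFinM -[leLHS]mul1e; apply: lee_wpmul2r => //.
    by rewrite lee_fin ler_pdivlMl// mulr1; apply: logpow_le => //; exact: ltW.
  apply: ge0_subset_integral => //.
  - by apply: measurable_funTS; exact: measurable_funeM.
  - move=> x /=; rewrite in_itv/= => /andP[_ x1]; apply: mule_ge0.
      by rewrite lee_fin invr_ge0 ltW.
    by apply: mule_ge0 => //; rewrite lee_fin logpow_ge0.
rewrite integral_logpow_prod_int// subnK//.
apply: lte_mul_pinfty; rewrite ?lee_fin ?invr_ge0 ?(ltW c0)//.
case/integrableP : inth => _; apply: le_lt_trans.
rewrite le_eqVlt; apply/orP; left; apply/eqP; apply: eq_integral => x.
rewrite inE/= in_itv/= => /andP[_ x1].
by rewrite -EFinM ger0_norm// mulr_ge0 ?logpow_ge0.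
Qed.

(* The inner integrals may diverge when the outer variable is 1, but they are
   finite for every outer variable in [0, 1), so g splits into its positive
   and negative parts at each stage. *)
Lemma cube_int_prod_signed n (g : R -> R) : measurable_fun setT g ->
  mu.-integrable I01 (fun x => (logpow n x * g x)%:E) ->
  cube_int n.+1 (fun t => (g (\prod_(x <- t) x))%:E) =
  (\int[mu]_(x in I01) (logpow n x * g x)%:E)%E.
Proof.
move=> mg intg.
pose gp x := (`|g x| + g x) / 2.
pose gn x := (`|g x| - g x) / 2.
have gE x : g x = gp x - gn x by rewrite /gp /gn; field.
have gp0 x : 0 <= gp x.
  by rewrite /gp divr_ge0// -lerBlDr sub0r -normrN ler_norm.
have gn0 x : 0 <= gn x by rewrite /gn divr_ge0// subr_ge0 ler_norm.
have gpn x : gp x + gn x = `|g x| by rewrite /gp /gn; field.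
have mgp : measurable_fun setT gp.
  by apply: measurable_funM => //; apply: measurable_funD => //; exact: measurableT_comp.
have mgn : measurable_fun setT gn.
  by apply: measurable_funM => //; apply: measurable_funB => //; exact: measurableT_comp.
have ml := @measurable_logpow R n.
have inth (h : R -> R) : measurable_fun setT h -> (forall x, 0 <= h x) ->
    (forall x, h x <= `|g x|) -> mu.-integrable I01 (fun x => (logpow n x * h x)%:E).
  move=> mh h0 hg; apply: le_integrable intg => //.
    by apply: measurable_funTS; apply/measurable_EFinP; exact: measurable_funM.
  move=> x _; rewrite !abse_EFin lee_fin !normrM ler_wpM2l//.
  by rewrite (ger0_norm (h0 x)).
have ip : mu.-integrable I01 (fun x => (logpow n x * gp x)%:E).
  by apply: inth => // x; rewrite -gpn lerDl.
have inn : mu.-integrable I01 (fun x => (logpow n x * gn x)%:E).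
  by apply: inth => // x; rewrite -gpn lerDr.
have megp : measurable_fun setT (EFin \o gp) by apply/measurable_EFinP.
have megn : measurable_fun setT (EFin \o gn) by apply/measurable_EFinP.
have egp0 x : (0 <= (EFin \o gp) x)%E by rewrite /= lee_fin.
have egn0 x : (0 <= (EFin \o gn) x)%E by rewrite /= lee_fin.
have split_int m (q : R) : (m <= n)%N -> 0 <= q < 1 -> prod_int m (EFin \o g) q =
    (prod_int m (EFin \o gp) q - prod_int m (EFin \o gn) q)%E.
  elim: m q => [|m ih] q mn /andP[q0 q1].
    by rewrite !prod_int0/= -EFinB -gE.
  rewrite !prod_intS -integralB//.
  - apply: eq_integral => x; rewrite inE/= in_itv/= => /andP[x0 x1].
    by rewrite ih ?(ltnW mn)// mulr_ge0//= (le_lt_trans _ q1)// ler_piMr.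
  - apply/integrableP; split.
      apply: measurable_funTS; apply: measurableT_comp => //.
      exact: measurable_prod_int.
    under eq_integral do rewrite gee0_abs ?prod_int_ge0//.
    by rewrite -prod_intS (@prod_int_lty n)// ?(leqW mn)// q0.
  - apply/integrableP; split.
      apply: measurable_funTS; apply: measurableT_comp => //.
      exact: measurable_prod_int.
    under eq_integral do rewrite gee0_abs ?prod_int_ge0//.
    by rewrite -prod_intS (@prod_int_lty n)// ?(leqW mn)// q0.
have mp := measurable_prod_int n megp egp0.
have mn := measurable_prod_int n megn egn0.
have prodE (h : R -> R) : measurable_fun setT h -> (forall x, 0 <= h x) ->
    (\int[mu]_(q in I01) prod_int n (EFin \o h) q =
     \int[mu]_(q in I01) (logpow n q * h q)%:E)%E.
  move=> mh h0; rewrite -cube_int_prod cube_int_ge0_prod//.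
  by apply/measurable_EFinP.
rewrite (cube_int_prod n (EFin \o g)).
have eqI : {in `[0%R, 1%R[%classic, prod_int n (EFin \o g) =1
    (fun q => prod_int n (EFin \o gp) q - prod_int n (EFin \o gn) q)%E}.
  move=> q; rewrite inE/= in_itv/= => q01; exact: split_int.
(* The null point q = 1 is removed, since the splitting is established only for q < 1. *)
rewrite -integral_itv_bndo_bndc; last first.
  apply: (@eq_measurable_fun _ _ _ _ _ (fun q =>
    prod_int n (EFin \o gp) q - prod_int n (EFin \o gn) q)%E) => [q qI|].
    by rewrite eqI.
  by apply: measurable_funTS; exact: emeasurable_funB.
transitivity (\int[mu]_(q in `[0%R, 1%R[)
    (prod_int n (EFin \o gp) q - prod_int n (EFin \o gn) q))%E.
  by apply: eq_integral => q qI; exact: eqI.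
rewrite integralB//; last 2 first.
- apply: (@integrableS _ _ _ mu I01) => //; last apply/integrableP.
    by apply: subset_itvl; rewrite bnd_simp.
  split; first exact: measurable_funTS.
  under eq_integral do rewrite gee0_abs ?prod_int_ge0//.
  rewrite prodE//; exact: integrable_lty.
- apply: (@integrableS _ _ _ mu I01) => //; last apply/integrableP.
    by apply: subset_itvl; rewrite bnd_simp.
  split; first exact: measurable_funTS.
  under eq_integral do rewrite gee0_abs ?prod_int_ge0//.
  rewrite prodE//; exact: integrable_lty.
rewrite !integral_itv_bndo_bndc; [|exact: measurable_funTS..].
rewrite !prodE// -integralB_EFin//; apply: eq_integral => x _.
by rewrite -EFinB -mulrBr -gE.
Qed.

End signed.
(** * Complex-valued functions of a real variable *)

Section complex_aux.
Context {R : realType}.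
Implicit Types x y : R[i].
Local Notation Re := complex.Re.
Local Notation Im := complex.Im.
Local Notation normc := Normc.normc.

Lemma cReD x y : Re (x + y) = Re x + Re y.
Proof. by case: x; case: y. Qed.
Lemma cImD x y : Im (x + y) = Im x + Im y.
Proof. by case: x; case: y. Qed.
Lemma cReB x y : Re (x - y) = Re x - Re y.
Proof. by case: x; case: y. Qed.
Lemma cReM x y : Re (x * y) = Re x * Re y - Im x * Im y.
Proof. by case: x; case: y. Qed.
Lemma cImM x y : Im (x * y) = Re x * Im y + Im x * Re y.
Proof. by case: x; case: y. Qed.
Lemma cReV x : Re x^-1 = Re x / (Re x ^+ 2 + Im x ^+ 2).
Proof. by case: x. Qed.
Lemma cImV x : Im x^-1 = - Im x / (Re x ^+ 2 + Im x ^+ 2).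
Proof. by case: x => a b /=; rewrite mulNr. Qed.

Lemma normc_sqrt x : normc x = Num.sqrt (Re x ^+ 2 + Im x ^+ 2).
Proof. by case: x. Qed.

Lemma normc_ge0 x : 0 <= normc x.
Proof. by rewrite normc_sqrt sqrtr_ge0. Qed.

Lemma le_Re_normc x : `|Re x| <= normc x.
Proof.
by rewrite normc_sqrt -sqrtr_sqr ler_sqrt ?lerDl ?sqr_ge0// addr_ge0 ?sqr_ge0.
Qed.

Lemma le_Im_normc x : `|Im x| <= normc x.
Proof.
by rewrite normc_sqrt -sqrtr_sqr ler_sqrt ?lerDr ?sqr_ge0// addr_ge0 ?sqr_ge0.
Qed.

Lemma normc_real (r : R) : normc (r%:C)%C = `|r|.
Proof. by rewrite normc_sqrt /= expr0n /= addr0 sqrtr_sqr. Qed.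

Lemma normcX x n : normc (x ^+ n) = normc x ^+ n.
Proof.
by elim: n => [|n ih]; rewrite ?expr0 ?Normc.normc1// !exprS Normc.normcM ih.
Qed.

Lemma normc_eq0 x : (normc x == 0) = (x == 0).
Proof. by apply/eqP/eqP => [/Normc.eq0_normc//|->]; rewrite Normc.normc0. Qed.

Lemma ler_normcB x y : normc x - normc y <= normc (x - y).
Proof. by rewrite lerBlDr -[in normc x](subrK y x) le_normcD. Qed.

Lemma complex_eq x y : Re x = Re y -> Im x = Im y -> x = y.
Proof. by case: x y => [a b] [c d] /= -> ->. Qed.

End complex_aux.

(** * Measurability, integrals and dominated convergence for complex-valued functions *)

Section complex_int.
Context {R : realType}.
Local Notation mu := (@lebesgue_measure R).
Local Notation I01 := (`[0%R, 1%R]%classic : set R).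
Local Notation Re := complex.Re.
Local Notation Im := complex.Im.
Local Notation normc := Normc.normc.
Implicit Types F G : R -> R[i].

Definition cmeasurable F :=
  measurable_fun setT (fun x => Re (F x)) /\ measurable_fun setT (fun x => Im (F x)).

Lemma cmeasurableD F G : cmeasurable F -> cmeasurable G ->
  cmeasurable (fun x => F x + G x).
Proof.
move=> [F1 F2] [G1 G2]; split.
  by under eq_fun do rewrite cReD; exact: measurable_funD.
by under eq_fun do rewrite cImD; exact: measurable_funD.
Qed.

Lemma cmeasurableM F G : cmeasurable F -> cmeasurable G ->
  cmeasurable (fun x => F x * G x).
Proof.
move=> [F1 F2] [G1 G2]; split.
  under eq_fun do rewrite cReM.
  by apply: measurable_funB; exact: measurable_funM.
under eq_fun do rewrite cImM.
by apply: measurable_funD; exact: measurable_funM.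
Qed.

Lemma cmeasurableV F : cmeasurable F -> cmeasurable (fun x => (F x)^-1).
Proof.
move=> [F1 F2].
have m : measurable_fun setT (fun x => (Re (F x) ^+ 2 + Im (F x) ^+ 2)^-1).
  apply: (measurableT_comp measurable_invr).
  by apply: measurable_funD; exact: measurable_funX.
split.
  by under eq_fun do rewrite cReV; exact: measurable_funM.
under eq_fun do rewrite cImV.
by apply: measurable_funM => //; exact: measurableT_comp.
Qed.

Lemma cmeasurable_real (f : R -> R) : measurable_fun setT f ->
  cmeasurable (fun x => ((f x)%:C)%C).
Proof. by move=> mf; split => //=. Qed.

Lemma cmeasurable_cst (c : R[i]) : cmeasurable (fun=> c).
Proof. by split. Qed.

Lemma cmeasurableX F n : cmeasurable F -> cmeasurable (fun x => F x ^+ n).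
Proof.
move=> mF; elim: n => [|n ih].
  by under eq_fun do rewrite expr0; exact: cmeasurable_cst.
by under eq_fun do rewrite exprS; exact: cmeasurableM.
Qed.

Lemma cmeasurable_sum N (F : nat -> R -> R[i]) :
  (forall k, cmeasurable (F k)) -> cmeasurable (fun x => \sum_(k < N) F k x).
Proof.
move=> mF; elim: N => [|N ih].
  by under eq_fun do rewrite big_ord0; exact: cmeasurable_cst.
by under eq_fun do rewrite big_ord_recr /=; exact: cmeasurableD.
Qed.

Lemma cmeasurable_cpowR w : cmeasurable (fun x => cpowR x w).
Proof.
have ml := @measurable_ln R.
apply: cmeasurableM.
  apply: cmeasurable_real; apply: (measurableT_comp (@measurable_expR R)).
  exact: measurable_funM.
split => /=.
  apply: measurableT_comp; last exact: measurable_funM.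
  by apply: continuous_measurable_fun; exact: continuous_cos.
apply: measurableT_comp; last exact: measurable_funM.
by apply: continuous_measurable_fun; exact: continuous_sin.
Qed.

Lemma measurable_normc F : cmeasurable F ->
  measurable_fun setT (fun x => normc (F x)).
Proof.
move=> [F1 F2]; under eq_fun do rewrite normc_sqrt.
apply: measurableT_comp.
  by apply: continuous_measurable_fun; exact: sqrt_continuous.
by apply: measurable_funD; exact: measurable_funX.
Qed.

(** Measurability is asked on the whole line, as the reduction of the cube integral requires, but
    integrability only on [[0, 1]]. *)
Definition cintegrable F :=
  cmeasurable F /\ mu.-integrable I01 (fun x => (normc (F x))%:E).

Definition cintegral F : R[i] :=
  Complex (\int[mu]_(x in I01) Re (F x))%R (\int[mu]_(x in I01) Im (F x))%R.

Lemma cintegrable_Re F : cintegrable F ->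
  mu.-integrable I01 (fun x => (Re (F x))%:E).
Proof.
move=> [[F1 F2] iF]; apply: le_integrable iF => //.
  by apply: measurable_funTS; exact/measurable_EFinP.
move=> x _; rewrite !abse_EFin lee_fin (ger0_norm (normc_ge0 _)).
exact: le_Re_normc.
Qed.

Lemma cintegrable_Im F : cintegrable F ->
  mu.-integrable I01 (fun x => (Im (F x))%:E).
Proof.
move=> [[F1 F2] iF]; apply: le_integrable iF => //.
  by apply: measurable_funTS; exact/measurable_EFinP.
move=> x _; rewrite !abse_EFin lee_fin (ger0_norm (normc_ge0 _)).
exact: le_Im_normc.
Qed.

Lemma cintegrable_le F (g : R -> R) : cmeasurable F ->
  mu.-integrable I01 (fun x => (g x)%:E) ->
  (forall x, 0 <= x <= 1 -> normc (F x) <= g x) -> cintegrable F.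
Proof.
move=> mF ig Fg; split => //; apply: le_integrable ig => //.
  by apply: measurable_funTS; apply/measurable_EFinP; exact: measurable_normc.
move=> x /=; rewrite in_itv/= => x01.
by rewrite lee_fin ger0_norm ?normc_ge0// (le_trans (Fg _ x01))// ler_norm.
Qed.

Lemma eq_cintegral F G : (forall x, 0 <= x <= 1 -> F x = G x) ->
  cintegral F = cintegral G.
Proof.
move=> FG; rewrite /cintegral; congr Complex; apply: eq_Rintegral => x;
  by rewrite inE/= in_itv/= => x01; rewrite FG.
Qed.

Lemma cintegralZ c F : cintegrable F ->
  cintegral (fun x => c * F x) = c * cintegral F.
Proof.
move=> iF; have iRe := cintegrable_Re iF; have iIm := cintegrable_Im iF.
apply: complex_eq; rewrite /cintegral ?cReM ?cImM /=.
  under eq_Rintegral do rewrite cReM.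
  rewrite RintegralB//; first by rewrite !RintegralZl.
    exact: (integrableZl _ (Re c) iRe).
  exact: (integrableZl _ (Im c) iIm).
under eq_Rintegral do rewrite cImM.
rewrite RintegralD//; first by rewrite !RintegralZl.
  exact: (integrableZl _ (Re c) iIm).
exact: (integrableZl _ (Im c) iRe).
Qed.

Lemma cintegrableD F G : cintegrable F -> cintegrable G ->
  cintegrable (fun x => F x + G x).
Proof.
move=> iF iG; apply: (@cintegrable_le _ (fun x => normc (F x) + normc (G x))).
- by apply: cmeasurableD; [case: iF|case: iG].
- case: iF => _ iF; case: iG => _ iG.
  exact: (integrableD _ iF iG).
- by move=> x _; exact: le_normcD.
Qed.

Lemma cintegrable0 : cintegrable (fun=> 0).
Proof.
split; first exact: cmeasurable_cst.
by rewrite Normc.normc0; exact: integrable0.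
Qed.

Lemma cintegralD F G : cintegrable F -> cintegrable G ->
  cintegral (fun x => F x + G x) = cintegral F + cintegral G.
Proof.
move=> iF iG; have iFR := cintegrable_Re iF; have iFI := cintegrable_Im iF.
have iGR := cintegrable_Re iG; have iGI := cintegrable_Im iG.
apply: complex_eq; rewrite /cintegral ?cReD ?cImD /=.
  by under eq_Rintegral do rewrite cReD; rewrite RintegralD.
by under eq_Rintegral do rewrite cImD; rewrite RintegralD.
Qed.

Lemma cintegral_sum N (F : nat -> R -> R[i]) :
  (forall k, cintegrable (F k)) ->
  cintegral (fun x => \sum_(k < N) F k x) = \sum_(k < N) cintegral (F k).
Proof.
(* Additivity at the next stage needs the partial sum to be integrable, so both claims are proved
   together. *)
move=> iF; suff : cintegrable (fun x => \sum_(k < N) F k x) /\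
  cintegral (fun x => \sum_(k < N) F k x) = \sum_(k < N) cintegral (F k) by case.
elim: N => [|N [ih1 ih2]].
  under eq_fun do rewrite big_ord0.
  rewrite big_ord0; split; first exact: cintegrable0.
  by rewrite /cintegral /= Rintegral_cst// mul0r.
under eq_fun do rewrite big_ord_recr /=.
rewrite big_ord_recr /= -ih2; split; first exact: cintegrableD.
exact: cintegralD.
Qed.

Lemma dominated_cvg_cintegral (F_ : nat -> R -> R[i]) F (g : R -> R) :
  (forall n, cmeasurable (F_ n)) -> cmeasurable F ->
  mu.-integrable I01 (fun x => (g x)%:E) ->
  (forall n x, 0 <= x <= 1 -> normc (F_ n x) <= g x) ->
  (forall x, 0 <= x <= 1 -> normc (F_ n x - F x) @[n --> \oo] --> (0 : R)) ->
  (Re (cintegral (F_ n)) @[n --> \oo] --> Re (cintegral F)) /\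
  (Im (cintegral (F_ n)) @[n --> \oo] --> Im (cintegral F)).
Proof.
move=> mF_ mF ig Fg cF.
(* Here [p] is the real or the imaginary part: both respect differences and are bounded by the
   modulus, so one application of real dominated convergence serves for both. *)
have aux (p : R[i] -> R) : (forall x y, p (x - y) = p x - p y) ->
    (forall x, `|p x| <= normc x) ->
    (forall n, measurable_fun setT (fun x => p (F_ n x))) ->
    measurable_fun setT (fun x => p (F x)) ->
    (\int[mu]_(x in I01) p (F_ n x))%R @[n --> \oo] -->
    (\int[mu]_(x in I01) p (F x))%R.
  move=> pB pn mp_ mp.
  have [| | |//| |iF _ cI] := @dominated_convergence _ _ _ mu I01 (measurable_itv _)
    (fun n x => (p (F_ n x))%:E) (fun x => (p (F x))%:E) (fun x => (g x)%:E).
  - by move=> n; apply: measurable_funTS; apply/measurable_EFinP; exact: mp_.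
  - by apply: measurable_funTS; exact/measurable_EFinP.
  - apply: aeW => x /=; rewrite in_itv/= => x01.
    apply: cvg_EFin; first by apply: nearW.
    apply/cvgrPdist_le => e e0; have /cvgrPdist_le/(_ e e0) := cF x x01.
    apply: filterS => n; rewrite sub0r normrN (ger0_norm (normc_ge0 _)) => h.
    by rewrite distrC /= -pB (le_trans (pn _)).
  - apply: aeW => x n /=; rewrite in_itv/= => x01.
    by rewrite lee_fin (le_trans (pn _))// Fg.
  by apply: fine_cvg; rewrite fineK ?integrable_fin_num//.
split.
  apply: aux => //; [by case=> a b [c d]|exact: le_Re_normc| |by case: mF].
  by move=> n; case: (mF_ n).
apply: aux => //; [by case=> a b [c d]|exact: le_Im_normc| |by case: mF].
by move=> n; case: (mF_ n).
Qed.

End complex_int.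
(** * Moments of the powers of the logarithm *)

Section moments.
Context {R : realType}.
Local Notation mu := (@lebesgue_measure R).
Local Notation I01 := (`[0%R, 1%R]%classic : set R).
Local Notation Re := complex.Re.
Local Notation Im := complex.Im.
Local Notation normc := Normc.normc.
Implicit Types F G : R -> R[i].

Lemma Re_cpowR (y : R) w : Re (cpowR y w) = expR (Re w * ln y) * cos (Im w * ln y).
Proof. by rewrite /cpowR cReM /= mul0r subr0. Qed.

Lemma Im_cpowR (y : R) w : Im (cpowR y w) = expR (Re w * ln y) * sin (Im w * ln y).
Proof. by rewrite /cpowR cImM /= mul0r addr0. Qed.

(** The addition formulas of exp, cos and sin; valid for every real y, since [cpowR] depends on y
    through [ln y] only. In particular [cpowR 0 w] is 1. *)
Lemma cpowRD (y : R) v w : cpowR y (v + w) = cpowR y v * cpowR y w.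
Proof.
apply: complex_eq; [rewrite [RHS]cReM|rewrite [RHS]cImM];
  rewrite !Re_cpowR !Im_cpowR cReD cImD !mulrDl expRD ?cosD ?sinD; ring.
Qed.

Lemma cpowR0 (y : R) : cpowR y 0 = 1.
Proof.
by apply: complex_eq; rewrite ?Re_cpowR ?Im_cpowR /= !mul0r expR0
  ?cos0 ?sin0 ?mulr1 ?mulr0.
Qed.

Lemma cpowR1 (y : R) : 0 < y -> cpowR y 1 = (y%:C)%C.
Proof.
move=> y0; apply: complex_eq; rewrite ?Re_cpowR ?Im_cpowR /= !mul0r mul1r lnK ?posrE//.
  by rewrite cos0 mulr1.
by rewrite sin0 mulr0.
Qed.

Lemma cpowR_nat (y : R) n : 0 < y -> cpowR y n%:R = (y%:C)%C ^+ n.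
Proof.
move=> y0; elim: n => [|n ih]; first by rewrite cpowR0.
by rewrite -natr1 cpowRD ih cpowR1// exprSr.
Qed.

Lemma cpow1R w : cpowR (1 : R) w = 1.
Proof.
by apply: complex_eq; rewrite ?Re_cpowR ?Im_cpowR /= ln1 !mulr0 expR0
  ?cos0 ?sin0 ?mulr1 ?mulr0.
Qed.

Lemma normc_cpowR (y : R) w : normc (cpowR y w) = expR (Re w * ln y).
Proof.
rewrite normc_sqrt Re_cpowR Im_cpowR !exprMn -mulrDr cos2Dsin2 mulr1.
by rewrite sqrtr_sqr ger0_norm ?expR_ge0.
Qed.

(** The derivative along the real line, taken componentwise, of a complex-valued function. *)
Definition cder F (y : R) (d : R[i]) :=
  is_derive y 1 (fun x => Re (F x)) (Re d) /\
  is_derive y 1 (fun x => Im (F x)) (Im d).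

Lemma cderD F G (y : R) d e : cder F y d -> cder G y e ->
  cder (fun x => F x + G x) y (d + e).
Proof.
move=> [F1 F2] [G1 G2]; split.
  by under eq_fun do rewrite cReD; rewrite cReD; exact: is_deriveD.
by under eq_fun do rewrite cImD; rewrite cImD; exact: is_deriveD.
Qed.

Lemma cderM F G (y : R) d e : cder F y d -> cder G y e ->
  cder (fun x => F x * G x) y (d * G y + F y * e).
Proof.
move=> [F1 F2] [G1 G2]; split.
  under eq_fun do rewrite cReM.
  apply: (is_derive_eq (is_deriveB (is_deriveM F1 G1) (is_deriveM F2 G2))).
  rewrite cReD !cReM /GRing.scale /=; ring.
under eq_fun do rewrite cImM.
apply: (is_derive_eq (is_deriveD (is_deriveM F1 G2) (is_deriveM F2 G1))).
rewrite cImD !cImM /GRing.scale /=; ring.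
Qed.

Lemma cder_cst c (y : R) : cder (fun=> c) y 0.
Proof. by split; exact: is_derive_cst. Qed.

Lemma cderMr F (y : R) d c : cder F y d -> cder (fun x => F x * c) y (d * c).
Proof.
by move=> dF; have := cderM dF (cder_cst c y); rewrite mulr0 addr0.
Qed.

Lemma cder_real (f : R -> R) (y d : R) : is_derive y 1 f d ->
  cder (fun x => ((f x)%:C)%C) y (d%:C)%C.
Proof. by move=> df; split => //=; exact: is_derive_cst. Qed.

Lemma cder_cpowR w (y : R) : 0 < y ->
  cder (fun x => cpowR x w) y (w * cpowR y (w - 1)).
Proof.
move=> y0.
have cE : cpowR y (w - 1) = cpowR y w * (y^-1%:C)%C.
  rewrite -[in RHS](subrK 1 w) [in RHS]cpowRD cpowR1// -mulrA -rmorphM/=.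
  by rewrite mulfV ?mulr1// gt_eqF.
have dl (r : R) : is_derive y 1 (fun x => r * ln x) (r * y^-1).
  exact: (is_deriveZ r (is_derive1_ln y0)).
have de := is_derive1_comp (is_derive_expR _) (dl (Re w)).
have dc := is_derive1_comp (is_derive_cos _) (dl (Im w)).
have ds := is_derive1_comp (is_derive_sin _) (dl (Im w)).
rewrite {}cE; have cR := Re_cpowR y w; have cI := Im_cpowR y w.
split.
  under eq_fun do rewrite Re_cpowR.
  apply: (is_derive_eq (is_deriveM de dc)).
  (* Only the two components of the power matter from here on; with the power abstracted, [ring] can
     close the identity. *)
  move: (cpowR y w) cR cI => c cR cI.
  rewrite !cReM !cImM cR cI /GRing.scale /=; ring.
under eq_fun do rewrite Im_cpowR.
apply: (is_derive_eq (is_deriveM de ds)).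
move: (cpowR y w) cR cI => c cR cI.
rewrite !cImM !cReM cR cI /GRing.scale /=; ring.
Qed.

(** Differentiability of [f] is assumed only to supply the continuity required by the fundamental
    theorem of calculus. *)
Lemma integral_cder F f (a b : R) : 0 < a -> a <= b ->
  (forall y, 0 < y -> cder F y (f y)) ->
  (forall y, 0 < y -> exists d, cder f y d) ->
  (\int[mu]_(x in `[a, b]) (Re (f x))%:E = (Re (F b) - Re (F a))%:E)%E /\
  (\int[mu]_(x in `[a, b]) (Im (f x))%:E = (Im (F b) - Im (F a))%:E)%E.
Proof.
move=> a0 ab dF df; split.
  apply: (@integral_is_derive_pos _ (fun x => Re (F x))) => // x x0.
    by case: (dF x x0).
  have [d [[h _] _]] := df x x0.
  by apply: differentiable_continuous; apply/derivable1_diffP.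
apply: (@integral_is_derive_pos _ (fun x => Im (F x))) => // x x0.
  by case: (dF x x0).
have [d [_ [h _]]] := df x x0.
by apply: differentiable_continuous; apply/derivable1_diffP.
Qed.

(** The antiderivative of y^(w-1) (- ln y)^m / m! produced by m integrations by parts. *)
Fixpoint moment_prim (w : R[i]) (m : nat) (y : R) : R[i] :=
  match m with
  | 0%N => cpowR y w / w
  | k.+1 => (cpowR y w * ((logpow k.+1 y)%:C)%C + moment_prim w k y) / w
  end.

Lemma logpow0 (y : R) : logpow 0 y = 1.
Proof. by rewrite /logpow expr0 fact0 divr1. Qed.

Lemma logpow_at1 k : (0 < k)%N -> logpow k (1 : R) = 0.
Proof. by case: k => // k _; rewrite /logpow ln1 oppr0 expr0n /= mul0r. Qed.

(* ln 0 = 0 here. *)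
Lemma logpow_at0 k : (0 < k)%N -> logpow k (0 : R) = 0.
Proof. by case: k => // k _; rewrite /logpow ln0// oppr0 expr0n /= mul0r. Qed.

(** The term coming from the derivative of the logarithmic factor cancels the derivative of the
    previous primitive. *)
Lemma cder_moment_prim w m (y : R) : w != 0 -> 0 < y ->
  cder (moment_prim w m) y (cpowR y (w - 1) * ((logpow m y)%:C)%C).
Proof.
move=> w0 y0; elim: m => [|m ih] /=.
  rewrite logpow0 mulr1; have := cderMr w^-1 (cder_cpowR w y0).
  by rewrite mulrAC mulfV// mul1r.
have dl := cder_real (is_derive_logpow m y0).
have := cderMr w^-1 (cderD (cderM (cder_cpowR w y0) dl) ih).
congr cder.
rewrite -[in cpowR y w](subrK 1 w) [in cpowR y (_ + 1)]cpowRD cpowR1//.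
rewrite rmorphN rmorphM/= fmorphV.
have yC0 : (y%:C)%C != 0 by rewrite fmorph_eq0 gt_eqF.
by field; apply/and3P; split => //; rewrite pnatr_eq0 -lt0n fact_gt0.
Qed.

(** At 1 all positive powers of the logarithm vanish, and each level contributes a factor 1 / w. *)
Lemma moment_prim1 w m : moment_prim w m 1 = (w ^+ m.+1)^-1.
Proof.
elim: m => [|m ih] /=; first by rewrite cpow1R mul1r expr1.
by rewrite logpow_at1// mulr0 add0r ih -invfM -exprSr.
Qed.

(** From e^x >= x^(m+1) / (m+1)! at x = rho (n+1), the sequence is at most C / (n+1) with C = (m+1)!
    / rho^(m+1). *)
Lemma cvg_expRN_pow (rho : R) m : 0 < rho ->
  expR (- (rho * n.+1%:R)) * n.+1%:R ^+ m @[n --> \oo] --> (0 : R).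
Proof.
move=> r0.
pose C : R := m.+1`!%:R / rho ^+ m.+1.
have C0 : 0 < C by rewrite divr_gt0 ?exprn_gt0// ltr0n fact_gt0.
apply: (@squeeze_cvgr _ _ _ _ (fun=> 0) (fun n => C * harmonic n)).
- apply: nearW => n; rewrite mulr_ge0 ?expR_ge0 ?exprn_ge0//=.
  rewrite expRN mulrC ler_pdivrMr ?expR_gt0//.
  have rn0 : 0 <= rho * n.+1%:R by rewrite mulr_ge0// ltW.
  have := expR_ge1Dxn m rn0 => /(le_trans _) h.
  have {h} : (rho * n.+1%:R) ^+ m.+1 / m.+1`!%:R <= expR (rho * n.+1%:R).
    by apply: h; rewrite lerDr.
  rewrite -(ler_pM2l (mulr_gt0 C0 (_ : 0 < harmonic n))); last first.
    by rewrite /harmonic invr_gt0.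
  apply: le_trans; rewrite le_eqVlt; apply/orP; left; apply/eqP.
  rewrite /C /harmonic /= exprMn (exprS n.+1%:R).
  have P0 : rho ^+ m.+1 != 0 by rewrite expf_neq0// gt_eqF.
  have N0 : n.+1%:R != 0 :> R by rewrite pnatr_eq0.
  have M0 : m.+1`!%:R != 0 :> R by rewrite pnatr_eq0 -lt0n fact_gt0.
  move: (rho ^+ m.+1) (n.+1%:R : R) (m.+1`!%:R : R) (n.+1%:R ^+ m) P0 N0 M0.
  by move=> P N M Nm P0 N0 M0; field; rewrite ?P0 ?N0 ?M0.
- exact: cvg_cst.
- by rewrite -[X in _ --> X](mulr0 C); apply: cvgM; [exact: cvg_cst|exact: cvg_harmonic].
Qed.

(** The endpoint 0 is approached along y = e^-(n+1), where - ln y = n + 1 and y^w has modulus e^(-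
    Re w (n+1)), which beats every power of n + 1. *)
Lemma cvg_moment_prim w m : 0 < Re w ->
  normc (moment_prim w m (expR (- n.+1%:R))) @[n --> \oo] --> (0 : R).
Proof.
move=> w0.
have base k : normc (cpowR (expR (- n.+1%:R)) w *
    ((logpow k (expR (- n.+1%:R)))%:C)%C) @[n --> \oo] --> (0 : R).
  rewrite -[X in _ --> X](mul0r (k`!%:R^-1)).
  under eq_cvg => n.
    rewrite Normc.normcM normc_cpowR normc_real /logpow expRK opprK.
    rewrite mulrN ger0_norm ?divr_ge0 ?exprn_ge0// mulrA.
    over.
  apply: cvgM; last exact: cvg_cst.
  exact: cvg_expRN_pow.
elim: m => [|m ih] /=.
  rewrite -[X in _ --> X](mul0r (normc w^-1)).
  under eq_cvg do rewrite Normc.normcM; apply: cvgM; last exact: cvg_cst.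
  by have := base 0%N; under eq_cvg do rewrite logpow0 mulr1.
rewrite -[X in _ --> X](mul0r (normc w^-1)).
under eq_cvg do rewrite Normc.normcM; apply: cvgM; last exact: cvg_cst.
apply: (@squeeze_cvgr _ _ _ _ (fun=> 0) (fun n => normc (cpowR (expR (- n.+1%:R)) w *
    ((logpow m.+1 (expR (- n.+1%:R)))%:C)%C) +
    normc (moment_prim w m (expR (- n.+1%:R))))).
- by apply: nearW => n; rewrite normc_ge0 le_normcD.
- exact: cvg_cst.
- by rewrite -[X in _ --> X](addr0 0); apply: cvgD.
Qed.

(** The integral over [[e n, 1]] is computed from the primitive; as [e n] tends to 0, dominated
    convergence gives the integral over [[0, 1]], while the primitive at [e n] tends to 0. *)
Lemma cintegral_moment m (w : R[i]) : (0 < m)%N -> 0 < Re w ->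
  cintegrable (fun y => cpowR y (w - 1) * ((logpow m y)%:C)%C) ->
  cintegral (fun y => cpowR y (w - 1) * ((logpow m y)%:C)%C) = (w ^+ m.+1)^-1.
Proof.
move=> m0 w0; set f := (fun y => _) => ifw.
have wn0 : w != 0 by apply: contraTneq w0 => ->; rewrite ltxx.
(* Every truncation vanishes at 0, so pointwise convergence there needs this value; it relies on m >
   0 and [ln 0 = 0]. *)
have f0 : f 0 = 0 by rewrite /f logpow_at0// mulr0.
pose e n : R := expR (- n.+1%:R).
have e0 n : 0 < e n by exact: expR_gt0.
have e1 n : e n <= 1 by rewrite -expR0 ler_expR oppr_le0.
pose f_ n y := if e n <= y then f y else 0.
have mf : cmeasurable f by case: ifw.
have mf_ n : cmeasurable (f_ n).
  case: mf => mR mI; split.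
    rewrite (_ : (fun _ => _) = fun y => if e n <= y then Re (f y) else 0).
      by apply: measurable_fun_ifT => //; exact: measurable_fun_ler.
    by apply/funext => y; rewrite /f_; case: ifP.
  rewrite (_ : (fun _ => _) = fun y => if e n <= y then Im (f y) else 0).
    by apply: measurable_fun_ifT => //; exact: measurable_fun_ler.
  by apply/funext => y; rewrite /f_; case: ifP.
have [|x x01|cR cI] := dominated_cvg_cintegral mf_ mf (proj2 ifw).
- move=> n x x01; rewrite /f_; case: ifP => // _.
  by rewrite Normc.normc0 normc_ge0.
- have [->|xn0] := eqVneq x 0.
    under eq_cvg do rewrite /f_ leNgt e0 f0 subr0 Normc.normc0.
    exact: cvg_cst.
  have x0 : 0 < x by case/andP : x01 => x0 _; rewrite lt_neqAle eq_sym xn0.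
  (* From this rank on n + 1 > - ln x, hence [e n <= x] and the truncation agrees with [f] at x. *)
  apply/cvgrPdist_le => r r0; exists (Num.truncn (- ln x)) => // n /= nx.
  suff enx : e n <= x by rewrite /f_ enx subrr Normc.normc0 subrr normr0 ltW.
  rewrite /e -[leRHS]lnK ?posrE// ler_expR lerNl.
  by rewrite (le_trans (ltW (truncnS_gt _)))// ler_nat ltnS.
have df y : 0 < y -> exists d, cder f y d.
  move=> y0; have := cder_real (is_derive_logpow m.-1 y0).
  rewrite (prednK m0) => dl; eexists.
  exact: (cderM (cder_cpowR (w - 1) y0) dl).
have dF y : 0 < y -> cder (moment_prim w m) y (f y).
  by move=> y0; exact: cder_moment_prim.
have restrict (p : R[i] -> R) n : p 0 = 0 ->
   (\int[mu]_(x in I01) (p (f_ n x))%:E = \int[mu]_(x in `[e n, 1%R]) (p (f x))%:E)%E.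
  move=> p0; rewrite [LHS]integral_mkcond [RHS]integral_mkcond.
  apply: eq_integral => x _; rewrite !patchE !mem_setE !in_itv /= /f_.
  case: (leP (e n) x) => ex /=; last by rewrite p0 if_same.
  by rewrite (le_trans (ltW (e0 n)) ex).
have cF := @cvg_moment_prim w m w0.
have lim0 (p : R[i] -> R) : (forall x, `|p x| <= normc x) ->
    p (moment_prim w m (e n)) @[n --> \oo] --> (0 : R).
  move=> pn; apply/cvgrPdist_le => r r0.
  have /cvgrPdist_le/(_ r r0) := cF.
  apply: filterS => n; rewrite !sub0r !normrN (ger0_norm (normc_ge0 _)).
  exact: le_trans.
have Rlim : Re (cintegral (f_ n)) @[n --> \oo] --> Re (moment_prim w m 1).
  rewrite -[X in _ --> X]subr0 /cintegral /Rintegral /=.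
  under eq_cvg => n.
    rewrite (restrict (@complex.Re R))// (integral_cder (e0 n) (e1 n) dF df).1 /=.
    over.
  by apply: cvgB; [exact: cvg_cst|apply: lim0; exact: le_Re_normc].
have Ilim : Im (cintegral (f_ n)) @[n --> \oo] --> Im (moment_prim w m 1).
  rewrite -[X in _ --> X]subr0 /cintegral /Rintegral /=.
  under eq_cvg => n.
    rewrite (restrict (@complex.Im R))// (integral_cder (e0 n) (e1 n) dF df).2 /=.
    over.
  by apply: cvgB; [exact: cvg_cst|apply: lim0; exact: le_Im_normc].
rewrite -moment_prim1; apply: complex_eq.
- exact: (cvg_unique _ cR Rlim).
- exact: (cvg_unique _ cI Ilim).
Qed.

End moments.
(** * The Lerch transcendent *)

Section lerch.
Context {R : realType}.
Local Notation mu := (@lebesgue_measure R).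
Local Notation I01 := (`[0%R, 1%R]%classic : set R).
Local Notation Re := complex.Re.
Local Notation Im := complex.Im.
Local Notation normc := Normc.normc.
Implicit Types z a : R[i].

Lemma normc_le_ReIm (x : R[i]) : normc x <= `|Re x| + `|Im x|.
Proof.
rewrite normc_sqrt -[leRHS]ger0_norm ?addr_ge0// -sqrtr_sqr ler_sqrt ?sqr_ge0//.
rewrite sqrrD !real_normK ?num_real// addrAC lerDl mulrn_wge0// mulr_ge0//.
Qed.

Lemma normc_nat n : normc (n%:R : R[i]) = n%:R.
Proof. by rewrite -(rmorph_nat (real_complex R)) normc_real normr_nat. Qed.

(** Exponential against polynomial growth: r^n = e^(n ln r) is at least (n ln r)^(s+1) / (s+1)!,
    whereas (n + A)^s <= (2 n)^s once n >= A. *)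
Lemma exprn_not_le_pow (r A : R) s N : 1 < r -> 0 <= A ->
  ~ (forall n, (N <= n)%N -> r ^+ n <= (n%:R + A) ^+ s).
Proof.
move=> r1 A0 h.
have L0 : 0 < ln r by exact: ln_gt0.
(* The two estimates together would force n <= B, so an n beyond N, A and B contradicts them. *)
pose B : R := 2 ^+ s * s.+1`!%:R / ln r ^+ s.+1.
pose n := (N + Num.truncn A + Num.truncn B).+1.
have nN : (N <= n)%N by rewrite /n -addnA leqW// leq_addr.
have An : A <= n%:R.
  rewrite (le_trans (ltW (truncnS_gt A)))// ler_nat /n ltnS -addnA.
  by rewrite (leq_trans (leq_addr (Num.truncn B) _))// leq_addl.
have Bn : B < n%:R.
  by rewrite (lt_le_trans (truncnS_gt B))// ler_nat /n ltnS leq_addl.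
have n0 : 0 < n%:R :> R by rewrite ltr0n.
have f0 : 0 < s.+1`!%:R :> R by rewrite ltr0n fact_gt0.
have h1 : (n%:R * ln r) ^+ s.+1 / s.+1`!%:R <= r ^+ n.
  have -> : r ^+ n = expR (n%:R * ln r).
    by rewrite expRM_natl lnK// posrE (lt_trans ltr01).
  apply: le_trans (expR_ge1Dxn s _); first by rewrite lerDr.
  by rewrite mulr_ge0// ltW.
have h2 : (n%:R + A) ^+ s <= 2 ^+ s * n%:R ^+ s.
  rewrite -exprMn; apply: lerXn2r; rewrite ?nnegrE ?addr_ge0 ?mulr_ge0//.
  by rewrite mulr_natl mulr2n lerD2l.
have := le_trans (le_trans h1 (h n nN)) h2.
rewrite ler_pdivrMr// exprMn exprS -mulrA.
rewrite [_ * ln r ^+ _]mulrC mulrA [leRHS]mulrAC ler_pM2r ?exprn_gt0//.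
rewrite -ler_pdivlMr ?exprn_gt0// -/B => nB.
by have := lt_le_trans Bn nB; rewrite ltxx.
Qed.

(** The terms of a convergent series are eventually of modulus at most 1, that is |z|^n <= |n +
    a|^s, which growth excludes when |z| > 1. *)
Lemma lerch_defined_normc_le1 z s a : lerch_defined z s a -> normc z <= 1.
Proof.
move=> [ka [cR cI]]; rewrite leNgt; apply/negP => z1.
have diff (u : nat -> R) : cvgn u -> u n.+1 - u n @[n --> \oo] --> (0 : R).
  move=> cu; rewrite -[X in _ --> X](subrr (limn u)); apply: cvgB => //.
  by have := cu; rewrite -cvg_shiftS.
have {}cR := diff _ cR; have {}cI := diff _ cI.
(* A bound of 1/2 on each component bounds the modulus by 1. *)
have half : 0 < 2^-1 :> R by [].
have /cvgrPdist_le/(_ _ half) [N1 _ h1] := cR.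
have /cvgrPdist_le/(_ _ half) [N2 _ h2] := cI.
apply: (@exprn_not_le_pow (normc z) (normc a) s (maxn N1 N2) z1 (normc_ge0 a)).
move=> n; rewrite geq_max => /andP[n1 n2].
have tE : lerch_partial z s a n.+1 = lerch_partial z s a n + z ^+ n / (n%:R + a) ^+ s.
  by rewrite /lerch_partial big_ord_recr.
have := h1 n n1; have := h2 n n2.
rewrite /= !sub0r !normrN tE cReD cImD ![_ + _ - _]addrAC !subrr !add0r => hI hR.
have : normc (z ^+ n / (n%:R + a) ^+ s) <= 1.
  apply: (le_trans (normc_le_ReIm _)).
  by apply: (le_trans (lerD hR hI)); lra.
have na0 : 0 < normc (n%:R + a).
  by rewrite lt_neqAle normc_ge0 eq_sym normc_eq0 ka.
rewrite Normc.normcM Normc.normcV !normcX ler_pdivrMr ?exprn_gt0// mul1r.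
move=> /le_trans; apply; apply: lerXn2r; rewrite ?nnegrE ?addr_ge0 ?normc_ge0//.
by rewrite (le_trans (le_normcD _ _))// normc_nat.
Qed.

(** * The Lerch integrand in one variable *)

Definition lerch_core s a (y : R) : R[i] :=
  cpowR y (a - 1) * ((logpow s.-1 y)%:C)%C.

(** The one-variable integrand left once the logarithm in the denominator has cancelled one power of
    the weight. *)
Definition lerch_density z s a (y : R) : R[i] :=
  lerch_core s a y / (1 - z * (y%:C)%C).

(** The Lerch integrand as a function of the product y of the coordinates. *)
Definition lerch_fun z s a (y : R) : R[i] :=
  (- (s%:R)) * cpowR y (a - 1) / ((1 - z * (y%:C)%C) * ((ln y)%:C)%C).

(* At y = 0 and y = 1, where ln y = 0, both sides vanish because 1 < s. *)
Lemma logpow_lerch_fun z s a (y : R) : (1 < s)%N ->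
  ((logpow s y)%:C)%C * lerch_fun z s a y = lerch_density z s a y.
Proof.
move=> s1; rewrite /lerch_density /lerch_core /lerch_fun.
case: s s1 => // s s1 /=.
have [l0|l0] := eqVneq (ln y) 0.
  have lp0 k : (0 < k)%N -> logpow k y = 0.
    by case: k => // k _; rewrite /logpow l0 oppr0 expr0n /= mul0r.
  by rewrite !lp0// !rmorph0 mulr0 !mul0r.
have -> : logpow s.+1 y = logpow s y * (- ln y / s.+1%:R).
  rewrite /logpow exprSr factS natrM; field.
  by rewrite nat1r !pnatr_eq0 /= -lt0n fact_gt0.
move: (logpow s y) => l.
rewrite [in LHS]invfM !rmorphM rmorphN /= fmorphV rmorph_nat.
have sC : (s.+1%:R : R[i]) != 0 by rewrite pnatr_eq0.
have lC : ((ln y)%:C)%C != 0 :> R[i] by rewrite fmorph_eq0.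
move: (s.+1%:R : R[i]) sC ((ln y)%:C)%C lC (l%:C)%C (cpowR y (a - 1)) ((1 - _)^-1).
by move=> S S0 L L0 P W V; field; rewrite S0 L0.
Qed.

Lemma cmeasurable_one_sub z : cmeasurable (fun y : R => 1 - z * (y%:C)%C).
Proof.
apply: cmeasurableD; first exact: cmeasurable_cst.
rewrite (_ : (fun _ => _) = fun y : R => (- z) * (y%:C)%C); last first.
  by apply/funext => y; rewrite mulNr.
by apply: cmeasurableM; [exact: cmeasurable_cst|exact: cmeasurable_real].
Qed.

Lemma cmeasurable_lerch_core s a : cmeasurable (lerch_core s a).
Proof.
apply: cmeasurableM; first exact: cmeasurable_cpowR.
by apply: cmeasurable_real; exact: measurable_logpow.
Qed.

Lemma cmeasurable_lerch_density z s a : cmeasurable (lerch_density z s a).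
Proof.
apply: cmeasurableM; first exact: cmeasurable_lerch_core.
by apply: cmeasurableV; exact: cmeasurable_one_sub.
Qed.

Lemma cmeasurable_lerch_fun z s a : cmeasurable (lerch_fun z s a).
Proof.
apply: cmeasurableM.
  by apply: cmeasurableM; [exact: cmeasurable_cst|exact: cmeasurable_cpowR].
apply: cmeasurableV; apply: cmeasurableM; first exact: cmeasurable_one_sub.
by apply: cmeasurable_real; exact: measurable_ln.
Qed.

Lemma cintegrable_lerch_density z s a : (1 < s)%N ->
  cube_integrable s.+1 (lerch_integrand z s a) ->
  cintegrable (lerch_density z s a).
Proof.
move=> s1; rewrite /cube_integrable.
have mg := measurable_normc (cmeasurable_lerch_fun z s a).
rewrite (cube_int_ge0_prod s (g := fun y => (normc (lerch_fun z s a y))%:E));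
  last 2 first.
- exact/measurable_EFinP.
- by move=> x; rewrite lee_fin normc_ge0.
move=> fin; split; first exact: cmeasurable_lerch_density.
apply/integrableP; split.
  apply: measurable_funTS; apply/measurable_EFinP; apply: measurable_normc.
  exact: cmeasurable_lerch_density.
apply: le_lt_trans fin; rewrite le_eqVlt; apply/orP; left; apply/eqP.
apply: eq_integral => x; rewrite inE/= in_itv/= => /andP[_ x1].
rewrite ger0_norm ?normc_ge0// -logpow_lerch_fun// Normc.normcM normc_real.
by rewrite ger0_norm ?logpow_ge0// EFinM.
Qed.

(** The signed reduction is applied to each component; the weight is real, so it commutes with
    taking real and imaginary parts. *)
Lemma cube_integral_lerch z s a : (1 < s)%N ->
  cube_integrable s.+1 (lerch_integrand z s a) ->
  cube_integral s.+1 (lerch_integrand z s a) = cintegral (lerch_density z s a).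
Proof.
move=> s1 /(cintegrable_lerch_density s1) iH.
have [mR mI] := cmeasurable_lerch_fun z s a.
have HR x : logpow s x * Re (lerch_fun z s a x) = Re (lerch_density z s a x).
  by rewrite -(logpow_lerch_fun _ _ _ s1) [RHS]cReM /= mul0r subr0.
have HI x : logpow s x * Im (lerch_fun z s a x) = Im (lerch_density z s a x).
  by rewrite -(logpow_lerch_fun _ _ _ s1) [RHS]cImM /= mul0r addr0.
rewrite /cube_integral /cintegral; congr Complex.
  rewrite (cube_int_prod_signed (g := fun y => Re (lerch_fun z s a y)))//.
    by congr fine; apply: eq_integral => x _; rewrite HR.
  apply: eq_integrable (cintegrable_Re iH) => // x _; by rewrite -HR.
rewrite (cube_int_prod_signed (g := fun y => Im (lerch_fun z s a y)))//.
  by congr fine; apply: eq_integral => x _; rewrite HI.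
apply: eq_integrable (cintegrable_Im iH) => // x _; by rewrite -HI.
Qed.

(** The exponent s - 1 of the logarithm is positive. The case y = 1 matters because 1 - z y may
    vanish there. *)
Lemma lerch_core_edge s a (y : R) : (1 < s)%N -> y = 0 \/ y = 1 ->
  lerch_core s a y = 0.
Proof.
case: s => // s; rewrite ltnS => s0 y01; rewrite /lerch_core /=.
by case: y01 => ->; rewrite ?logpow_at1 ?logpow_at0// mulr0.
Qed.

(** The denominator satisfies |1 - z y| <= 2, and it is nonzero for y < 1. *)
Lemma normc_lerch_core_le z s a (y : R) : (1 < s)%N -> normc z <= 1 ->
  0 <= y <= 1 -> normc (lerch_core s a y) <= 2 * normc (lerch_density z s a y).
Proof.
move=> s1 z1 /andP[y0 y1].
have [y1'|yn1] := eqVneq y 1.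
  by rewrite lerch_core_edge; [rewrite Normc.normc0 mulr_ge0// normc_ge0|by []|right].
have {}y1 : y < 1 by rewrite lt_neqAle yn1.
have zy : normc (z * (y%:C)%C) <= y.
  by rewrite Normc.normcM normc_real ger0_norm// ler_piMl.
have d0 : 0 < normc (1 - z * (y%:C)%C).
  apply: lt_le_trans (ler_normcB _ _); rewrite Normc.normc1 subr_gt0.
  exact: le_lt_trans y1.
rewrite /lerch_density [normc (_ / _)]Normc.normcM Normc.normcV mulrA ler_pdivlMr// mulrC.
apply: ler_wpM2r; first exact: normc_ge0.
apply: (le_trans (le_normcD _ _)); rewrite normcN Normc.normc1.
by have := le_trans zy (ltW y1); lra.
Qed.

Lemma cintegrable_lerch_core z s a : (1 < s)%N -> normc z <= 1 ->
  cintegrable (lerch_density z s a) -> cintegrable (lerch_core s a).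
Proof.
move=> s1 z1 [_ iH].
apply: (cintegrable_le (g := fun y => 2 * normc (lerch_density z s a y))).
- exact: cmeasurable_lerch_core.
- exact: (integrableZl _ 2 iH).
- by move=> y y01; exact: normc_lerch_core_le.
Qed.

(* If Re a <= 0 then |lerch_core s a y| dominates (- ln y)^(s-1) / (s-1)! / y,
   whose integral over [e, 1] is unbounded as e tends to 0. *)
Lemma cintegrable_lerch_core_Re_gt0 s a : (1 < s)%N ->
  cintegrable (lerch_core s a) -> 0 < Re a.
Proof.
move=> s1 [mf ifc]; rewrite ltNge; apply/negP => a0.
pose M := fine (\int[mu]_(x in I01) (normc (lerch_core s a x))%:E)%E.
have ME : (\int[mu]_(x in I01) (normc (lerch_core s a x))%:E)%E = M%:E.
  by rewrite /M fineK//; exact: integrable_fin_num.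
have M0 : 0 <= M by rewrite fine_ge0// integral_ge0// => x _; rewrite lee_fin normc_ge0.
have mnc : measurable_fun setT (fun x => (normc (lerch_core s a x))%:E).
  by apply/measurable_EFinP; exact: measurable_normc.
have f1 : 1 <= s`!%:R :> R by rewrite ler1n fact_gt0.
(* Since t >= 1, at e = e^(-t) one gets [logpow s e] = t^s / s! >= t / s! = M + 1, which exceeds the
   total integral M. *)
pose t : R := s`!%:R * (M + 1).
have t1 : 1 <= t by rewrite /t -[leLHS]mulr1 ler_pM// lerDr.
pose e : R := expR (- t).
have e0 : 0 < e by exact: expR_gt0.
have core_ge x : e <= x -> x <= 1 ->
    logpow s.-1 x / x <= normc (lerch_core s a x).
  move=> ex x1; have x0 : 0 < x by exact: lt_le_trans ex.
  rewrite /lerch_core Normc.normcM normc_cpowR normc_real.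
  rewrite ger0_norm ?logpow_ge0// mulrC ler_wpM2r ?logpow_ge0//.
  (* Comparing exponents, 1 / x <= x^(Re a - 1) amounts to Re a * ln x >= 0, a product of two
     nonpositive numbers. *)
  rewrite -[in leLHS](lnK (x := x)) ?posrE// -expRN ler_expR cReB /=.
  by rewrite mulrBl mul1r lerDr mulr_le0// ln_le0.
have e1 : e <= 1 by rewrite -expR0 ler_expR oppr_le0 (le_trans ler01).
have : ((logpow s e)%:E <= M%:E)%E.
  rewrite -ME -[in logpow s](prednK (ltnW s1)) -integral_logpow//.
  have sub : `[e, 1%R] `<=` I01.
    by apply: subset_itvr; rewrite bnd_simp ltW.
  apply: (@le_trans _ _ (\int[mu]_(x in `[e, 1%R]) (normc (lerch_core s a x))%:E)%E).
    apply: ge0_le_integral => //.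
    - move=> x /=; rewrite in_itv/= => /andP[ex x1].
      by rewrite lee_fin divr_ge0 ?logpow_ge0// (le_trans (ltW e0)).
    - apply: measurable_funTS; apply/measurable_EFinP; apply: measurable_funM.
        exact: measurable_logpow.
      exact: measurable_invr.
    - exact: measurable_funTS.
    - move=> x /=; rewrite in_itv/= => /andP[ex x1].
      rewrite lee_fin; exact: core_ge.
  apply: ge0_subset_integral => //; first exact: measurable_funTS.
  by move=> x _; rewrite lee_fin normc_ge0.
rewrite lee_fin /logpow /e expRK opprK leNgt => /negP; apply.
apply: (@lt_le_trans _ _ (t / s`!%:R)).
  by rewrite /t mulrAC mulfV ?mul1r ?ltrDl// pnatr_eq0 -lt0n fact_gt0.
rewrite ler_pM2r ?invr_gt0 ?(lt_le_trans ltr01 f1)//.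
by rewrite -[leLHS]expr1 ler_weXn2l// ltnW.
Qed.

(** Since y^(a-1) y^k = y^(k+a-1), this is z^k times the moment with w = k + a and m = s - 1. *)
Lemma cintegral_lerch_core_pow z s a k : (1 < s)%N -> normc z <= 1 ->
  0 < Re a -> cintegrable (lerch_core s a) ->
  cintegrable (fun y => lerch_core s a y * (z * (y%:C)%C) ^+ k) /\
  cintegral (fun y => lerch_core s a y * (z * (y%:C)%C) ^+ k) =
    z ^+ k / (k%:R + a) ^+ s.
Proof.
move=> s1 z1 a0 icore.
have zy1 (c : R[i]) (y : R) : normc c <= 1 -> 0 <= y <= 1 -> normc (c * (y%:C)%C) <= 1.
  move=> c1 /andP[y0 y1]; rewrite Normc.normcM normc_real ger0_norm//.
  by rewrite mulr_ile1// normc_ge0.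
have mzy (c : R[i]) : cmeasurable (fun y : R => c * (y%:C)%C).
  by apply: cmeasurableM; [exact: cmeasurable_cst|exact: cmeasurable_real].
(* Used with c = z for the claim itself and with c = 1 after z^k has been taken out of the
   integral. *)
have ik (c : R[i]) : normc c <= 1 ->
    cintegrable (fun y => lerch_core s a y * (c * (y%:C)%C) ^+ k).
  move=> c1; apply: (cintegrable_le (g := fun y => normc (lerch_core s a y))).
  - apply: cmeasurableM; first exact: cmeasurable_lerch_core.
    exact: cmeasurableX.
  - by case: icore.
  - move=> y y01; rewrite Normc.normcM normcX ler_piMr ?normc_ge0//.
    by rewrite exprn_ile1// ?normc_ge0// zy1.
split; first exact: ik.
have i1 : cintegrable (fun y => lerch_core s a y * (1 * (y%:C)%C) ^+ k).
  by apply: ik; rewrite Normc.normc1.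
have momE (y : R) : 0 <= y <= 1 ->
    lerch_core s a y * (1 * (y%:C)%C) ^+ k =
    cpowR y (k%:R + a - 1) * ((logpow s.-1 y)%:C)%C.
  (* At 0 the law of exponents fails, as [cpowR 0] is constantly 1, but the logarithmic factor makes
     both sides zero. *)
  move=> /andP[y0 y1]; have [->|yn0] := eqVneq y 0.
    rewrite lerch_core_edge//; last by left.
    by rewrite logpow_at0 ?mulr0 ?mul0r// -ltnS prednK// ltnW.
  rewrite /lerch_core -addrA (cpowRD y k%:R) cpowR_nat; last first.
    by rewrite lt_neqAle eq_sym yn0.
  by rewrite mul1r; ring.
transitivity (z ^+ k * cintegral (fun y => lerch_core s a y * (1 * (y%:C)%C) ^+ k)).
  rewrite -cintegralZ//; apply: eq_cintegral => y _.
  by rewrite mul1r exprMn mulrCA.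
congr (_ * _).
rewrite (eq_cintegral momE) cintegral_moment.
- by rewrite prednK// ltnW.
- by rewrite -ltnS prednK// ltnW.
- rewrite cReD -(rmorph_nat (real_complex R)) /=.
  exact: ltr_wpDl.
- apply: (cintegrable_le (g := fun y => normc (lerch_core s a y * (1 * (y%:C)%C) ^+ k))).
  + apply: cmeasurableM; first exact: cmeasurable_cpowR.
    by apply: cmeasurable_real; exact: measurable_logpow.
  + by case: i1.
  + by move=> y y01; rewrite momE.
Qed.

(** By the moments, the partial sum is the integral of a truncated geometric series, equal to
    [lerch_density] times 1 - (z y)^N and hence dominated by twice its modulus. *)
Lemma cvg_lerch_partial z s a : (1 < s)%N -> normc z <= 1 ->
  cintegrable (lerch_density z s a) ->
  (Re (lerch_partial z s a N) @[N --> \oo] --> Re (cintegral (lerch_density z s a))) /\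
  (Im (lerch_partial z s a N) @[N --> \oo] --> Im (cintegral (lerch_density z s a))).
Proof.
move=> s1 z1 iH.
have icore := cintegrable_lerch_core s1 z1 iH.
have a0 := cintegrable_lerch_core_Re_gt0 s1 icore.
have mom k := cintegral_lerch_core_pow k s1 z1 a0 icore.
pose S N (y : R) := \sum_(k < N) lerch_core s a y * (z * (y%:C)%C) ^+ k.
have SE N : lerch_partial z s a N = cintegral (S N).
  rewrite /S (cintegral_sum N (F := fun k y => lerch_core s a y * (z * (y%:C)%C) ^+ k)).
    by rewrite /lerch_partial; apply: eq_bigr => k _; rewrite (mom k).2.
  by move=> k; exact: (mom k).1.
under eq_cvg do rewrite SE.
under [X in _ /\ (X @ _ --> _)]eq_fun do rewrite SE.
have geom N (y : R) : 0 <= y <= 1 ->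
    S N y = lerch_density z s a y * (1 - (z * (y%:C)%C) ^+ N).
  move=> /andP[y0 y1]; rewrite /S -mulr_sumr.
  have [y1'|yn1] := eqVneq y 1.
    by rewrite /lerch_density lerch_core_edge ?mul0r//; right.
  have d0 : 1 - z * (y%:C)%C != 0.
    rewrite -normc_eq0 gt_eqF//; apply: lt_le_trans (ler_normcB _ _).
    rewrite Normc.normc1 subr_gt0 Normc.normcM normc_real ger0_norm//.
    by rewrite (@le_lt_trans _ _ y)// ?ler_piMl// lt_neqAle yn1.
  rewrite /lerch_density -mulrA; congr (_ * _).
  move: (z * _) d0 => x d0; apply: (mulfI d0).
  by rewrite mulVKf// -opprB mulNr -subrX1 opprB.
apply: (dominated_cvg_cintegral (g := fun y => 2 * normc (lerch_density z s a y))).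
- move=> N; apply: (cmeasurable_sum N
    (F := fun k y => lerch_core s a y * (z * (y%:C)%C) ^+ k)) => k.
  apply: cmeasurableM; first exact: cmeasurable_lerch_core.
  apply: cmeasurableX; apply: cmeasurableM; first exact: cmeasurable_cst.
  exact: cmeasurable_real.
- exact: cmeasurable_lerch_density.
- by case: iH => _ iH; exact: (integrableZl _ 2 iH).
- move=> N y y01; rewrite geom// Normc.normcM mulrC ler_wpM2r ?normc_ge0//.
  apply: (le_trans (le_normcD _ _)); rewrite normcN Normc.normc1 normcX.
  rewrite -[leRHS](_ : 1 + 1 = 2)// lerD2l exprn_ile1// ?normc_ge0//.
  case/andP : y01 => y0 y1; rewrite Normc.normcM normc_real ger0_norm//.
  by rewrite mulr_ile1// normc_ge0.
- move=> y /[dup] y01 /andP[y0 y1].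
  have SB n : normc (S n y - lerch_density z s a y) =
      normc (lerch_density z s a y) * normc (z * (y%:C)%C) ^+ n.
    rewrite geom// mulrBr mulr1 addrAC subrr add0r normcN.
    by rewrite [LHS]Normc.normcM normcX.
  rewrite (funext SB).
  (* At y = 1 the powers of z y need not tend to 0, since |z| = 1 is allowed; there the density
     itself is zero. *)
  have [y1'|yn1] := eqVneq y 1.
    have d0 : lerch_density z s a y = 0.
      by rewrite /lerch_density lerch_core_edge ?mul0r//; right.
    rewrite d0 Normc.normc0; under eq_fun do rewrite mul0r.
    exact: cvg_cst.
  rewrite -[X in _ --> X](mulr0 (normc (lerch_density z s a y))).
  apply: cvgM; first exact: cvg_cst.
  apply: cvg_expr; rewrite ger0_norm ?normc_ge0// Normc.normcM normc_real ger0_norm//.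
  by rewrite (@le_lt_trans _ _ y)// ?ler_piMl// lt_neqAle yn1.
Qed.

Lemma lerch_cube_integral s z a : (1 < s)%N -> lerch_defined z s a ->
  cube_integrable s.+1 (lerch_integrand z s a) ->
  lerch z s a = cube_integral s.+1 (lerch_integrand z s a).
Proof.
move=> s1 def int; rewrite cube_integral_lerch//.
have z1 := lerch_defined_normc_le1 def.
have [cR cI] := cvg_lerch_partial s1 z1 (cintegrable_lerch_density s1 int).
by apply: complex_eq; apply/cvg_lim.
Qed.

(** * The zeta function as the case z = a = 1 *)

Lemma lerch_integrand1 s (t : seq R) :
  lerch_integrand 1 s 1 t = ((zeta_integrand s t)%:C)%C.
Proof.
rewrite /lerch_integrand /zeta_integrand subrr cpowR0 mulr1 mul1r.
by rewrite fmorph_div rmorphN rmorph_nat rmorphM rmorphB rmorph1.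
Qed.

(** With |z| = 1, [cvg_lerch_partial] yields both the convergence of the series and its sum from
    integrability. *)
Lemma zeta_cube_integral s : (1 < s)%N ->
  cube_integrable_real s.+1 (zeta_integrand (R := R) s) ->
  zeta R s = cube_integral_real s.+1 (zeta_integrand (R := R) s).
Proof.
move=> s1 int.
have intC : cube_integrable s.+1 (lerch_integrand (1 : R[i]) s 1).
  rewrite /cube_integrable (_ : (fun _ => _) = fun t => (`|zeta_integrand s t|)%:E)//.
  by apply/funext => t; rewrite lerch_integrand1 normc_real.
have z1 : normc (1 : R[i]) <= 1 by rewrite Normc.normc1.
have [cR _] := cvg_lerch_partial s1 z1 (cintegrable_lerch_density s1 intC).
have intE : Re (cintegral (lerch_density (1 : R[i]) s 1)) =
    cube_integral_real s.+1 (zeta_integrand (R := R) s).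
  rewrite -cube_integral_lerch//.
  transitivity (fine (cube_int s.+1
    (fun t => (Re (lerch_integrand (1 : R[i]) s 1 t))%:E))); first by [].
  congr (fine (cube_int _ _)).
  by apply/funext => t; rewrite lerch_integrand1.
rewrite intE in cR.
(* The sums for [zeta] run over 1 <= n < N, so shifting N by one matches them with the Lerch sums
   over k < N, where n = k + 1. *)
rewrite /zeta; apply/cvg_lim => //; rewrite -cvg_shiftS /=.
rewrite (_ : (fun _ => _) = fun N => Re (lerch_partial (1 : R[i]) s 1 N))//.
apply/funext => N; rewrite big_add1 /= big_mkord /lerch_partial.
rewrite (_ : \sum_(k < N) _ = ((\sum_(k < N) (k.+1%:R ^+ s)^-1 : R)%:C)%C)//.
rewrite rmorph_sum; apply: eq_bigr => k _ /=.
by rewrite expr1n mul1r natr1 fmorphV rmorphXn rmorph_nat.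
Qed.

End lerch.

Theorem theorem3p1 (R : realType) (s : nat) (z a : R[i]) :
  (1 < s)%N ->
  (lerch_defined z s a ->
   cube_integrable s.+1 (lerch_integrand z s a) ->
     lerch z s a = cube_integral s.+1 (lerch_integrand z s a)) /\
  (cube_integrable_real s.+1 (zeta_integrand (R:=R) s) ->
     zeta R s = cube_integral_real s.+1 (zeta_integrand (R:=R) s)).
Proof.
move=> s1; split; first exact: lerch_cube_integral.
exact: zeta_cube_integral.
Qed.
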